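(* For every integer $r\ge 2$, $\mathcal{PD}^{TJ}(K^{2,3}(P_{2r}))$ is isomorphic to the path $P_{r+1}$.
   Context: Graphs are finite and simple. $P_m$ denotes the path with $m$ vertices. For a connected graph $G$, $K^{2,3}(G)$ is the graph obtained from $G$ by deleting each edge $uv$ of $G$ and adding, for each deleted edge $uv$, three new vertices of degree 2, each adjacent to exactly $u$ and $v$. For a graph $G$ and a non-empty $S\subseteq V(G)$ define $P^0[S]=S$, $P^1[S]=N[S]$ (the union of the closed neighborhoods of vertices of $S$), and for $i\ge 2$, $P^i[S]=P^{i-1}[S]\cup\{u: N_G(v)\setminus P^{i-1}[S]=\{u\}\text{ for some }v\in P^{i-1}[S]\}$. $S$ is a power dominating set if $P^t[S]=V(G)$ for some $t$; it is minimum if it has the smallest cardinality among power dominating sets. The token jumping (TJ) reconfiguration graph $\mathcal{PD}^{TJ}(G)$ has as vertices all minimum power dominating sets of $G$, with $S$ and $S'$ adjacent if and only if $S$ is obtained from $S'$ by exchanging a single vertex, i.e. $|S\setminus S'|=|S'\setminus S|=1$. *)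

(* Defs.v *)
From HB Require Import structures.
From mathcomp Require Import all_boot.
From mathcomp Require Import boolp.

Set Implicit Arguments.
Unset Strict Implicit.
Unset Printing Implicit Defensive.

Record sgraph := SGraph {
  vertex :> finType;
  adj : rel vertex;
  adj_sym : symmetric adj;
  adj_irrefl : irreflexive adj }.

Arguments adj {s} x y : rename.

Definition isomorphic (G H : sgraph) : Prop :=
  exists2 f : G -> H, bijective f & forall x y : G, adj (f x) (f y) = adj x y.

Section PathGraph.

Variable m : nat.

Definition path_adj : rel 'I_m := fun i j => (i.+1 == j) || (j.+1 == i).

Lemma path_adj_sym : symmetric path_adj.
Proof. by move=> i j; rewrite /path_adj orbC. Qed.

Lemma path_adj_irrefl : irreflexive path_adj.
Proof. by move=> i; rewrite /path_adj orbb gtn_eqF. Qed.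

(* m counts vertices, not edges. *)
Definition path_graph : sgraph := SGraph path_adj_sym path_adj_irrefl.

End PathGraph.

Section Neighborhoods.

Variable G : sgraph.

Definition edges : {set {set G}} :=
  [set [set p.1; p.2] | p : G * G & adj p.1 p.2].

Definition open_nbhd (v : G) : {set G} := [set u | adj v u].

Definition closed_nbhd (v : G) : {set G} := v |: open_nbhd v.

Definition closed_nbhd_set (S : {set G}) : {set G} :=
  \bigcup_(v in S) closed_nbhd v.

End Neighborhoods.

Section K23.

Variable G : sgraph.

Definition edge_type : finType := {e : {set G} | e \in edges G}.

(* [inr (e, k)] is the k-th of the three new vertices that replace e. *)
Definition K23_vertex : finType := (G + edge_type * 'I_3)%type.

Definition K23_adj : rel K23_vertex := fun x y =>
  match x, y with
  | inl u, inr (e, _) => u \in val e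
  | inr (e, _), inl u => u \in val e
  | _, _ => false
  end.

Lemma K23_adj_sym : symmetric K23_adj.
Proof. by move=> [u|[e i]] [v|[f j]]. Qed.

Lemma K23_adj_irrefl : irreflexive K23_adj.
Proof. by move=> [u|[e i]]. Qed.

Definition K23 : sgraph := SGraph K23_adj_sym K23_adj_irrefl.

End K23.

Section PowerDomination.

Variable G : sgraph.

Definition force (P : {set G}) : {set G} :=
  P :|: [set u | [exists v in P, open_nbhd v :\: P == [set u]]].

(* [monitored S i] is P^i[S]. *)
Fixpoint monitored (S : {set G}) (i : nat) : {set G} :=
  match i with
  | 0 => S
  | 1 => closed_nbhd_set S
  | j.+1 => force (monitored S j)
  end.

Definition power_dominating (S : {set G}) : Prop :=
  S != set0 /\ exists t : nat, monitored S t = [set: G].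

Definition min_power_dominating (S : {set G}) : Prop :=
  power_dominating S /\
  forall S' : {set G}, power_dominating S' -> #|S| <= #|S'|.

(* Classical truth value [`[< _ >]]: a subtype needs a boolean predicate. *)
Definition min_pds : finType := {S : {set G} | `[< min_power_dominating S >]}.

Definition TJ_adj : rel min_pds := fun S S' =>
  (#|val S :\: val S'| == 1) && (#|val S' :\: val S| == 1).

Lemma TJ_adj_sym : symmetric TJ_adj.
Proof. by move=> S S'; rewrite /TJ_adj andbC. Qed.

Lemma TJ_adj_irrefl : irreflexive TJ_adj.
Proof. by move=> S; rewrite /TJ_adj setDv cards0. Qed.

Definition PD_TJ : sgraph := SGraph TJ_adj_sym TJ_adj_irrefl.

End PowerDomination.

(* Main.v *)
Require Import Defs.
From mathcomp Require Import all_boot.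
From mathcomp Require Import boolp zify.

Set Implicit Arguments.
Unset Strict Implicit.
Unset Printing Implicit Defensive.

(** The minimum power dominating sets of K23 G are exactly the minimum vertex
    covers of G, for any non-empty G without isolated vertices.  The three
    vertices that replace an edge uv are false twins: if none of u and v is
    chosen and two of the three are not chosen either, those two can never be
    told apart by a forcing step ([power_dominating_twins]).  So a power
    dominating set S contains, for every edge, an endpoint or two of its three
    copies ([two_copies]).  Sending each copy to an endpoint of its edge turns S
    into a vertex cover that is no larger; and since copies come in pairs, one
    copy may be dropped beforehand, so that the cover is strictly smaller as
    soon as S contains a copy ([shadow_cover_del]).  Conversely a vertex cover
    monitors all copies in the first step and all of G in the second
    ([cover_power_dominating]).

    For the path on 2r vertices, the perfect matching {2k, 2k+1} forces a
    minimum cover to pick exactly one vertex in each of the r pairs.  The edge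
    between 2k+1 and 2k+2 says that picking the even vertex in one pair entails
    picking the even vertex in the next, so the minimum covers are the r+1
    staircases: odd vertices in the first j pairs and even vertices after that
    ([min_cover_staircase]).  Two staircases differ in exactly the pairs lying
    between their thresholds ([staircase_diff]), so a token jump is a change of
    the threshold by one. *)

(** * False twins and power domination *)

(** A vertex adjacent to one twin is adjacent to the other, so as
    long as both are unmonitored neither can be its only unmonitored neighbour;
    hence the first of them to be monitored is chosen or next to a chosen
    vertex. *)
Lemma power_dominating_twins (G : sgraph) (S : {set G}) (x y : G) :
  power_dominating S -> x != y -> open_nbhd x = open_nbhd y ->
  [|| x \in S, y \in S | [exists z in S, adj x z]].
Proof.
move=> [_ [t St]] neq_xy twin; apply/negPn; rewrite !negb_or.
apply/negP => /and3P[xS yS /exists_inPn nbhS].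
have adjE z : adj z x = adj z y.
  by move/setP/(_ z): twin; rewrite !inE ![adj z _]adj_sym.
have nbrS z : z \in S -> adj z x = false.
  by move=> /nbhS /negbTE; rewrite adj_sym.
suff /andP[] : (x \notin monitored S t) && (y \notin monitored S t).
  by rewrite St inE.
elim: t {St} => [|[|t] IHt]; first by rewrite /= xS yS.
  apply/andP; split; apply/bigcupP => -[z zS]; rewrite !inE.
    by rewrite nbrS // orbF => /eqP xz; rewrite xz zS in xS.
  by rewrite -adjE nbrS // orbF => /eqP yz; rewrite yz zS in yS.
case/andP: IHt; set P := monitored S t.+1 => xP yP.
rewrite -[monitored S t.+2]/(force P) !inE !negb_or xP yP /=.
apply/andP; split; apply/exists_inPn => z zP; apply/negP => /eqP/setP zE.
- have := zE x; have := zE y; rewrite !inE xP yP eqxx eq_sym (negPf neq_xy).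
  by rewrite /= adjE => ->.
have := zE x; have := zE y; rewrite !inE xP yP eqxx (negPf neq_xy).
by rewrite /= adjE => ->.
Qed.

(** * Power domination in K23 G and vertex covers of G *)

Definition vertex_cover (G : sgraph) (C : {set G}) : Prop :=
  forall u v : G, adj u v -> (u \in C) || (v \in C).

Definition min_vertex_cover (G : sgraph) (C : {set G}) : Prop :=
  vertex_cover C /\ forall D : {set G}, vertex_cover D -> #|C| <= #|D|.

Section K23Theory.

Variable G : sgraph.

Implicit Types (S : {set K23 G}) (C D : {set G}) (e : edge_type G).

Definition base (u : G) : K23 G := inl u.
Definition copy e (i : 'I_3) : K23 G := inr (e, i).

Lemma base_inj : injective base. Proof. by move=> u v []. Qed.

Lemma card_base_diff C D : #|(base @: C) :\: (base @: D)| = #|C :\: D|.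
Proof.
rewrite !cardsD -imsetI ?card_imset //; try exact: base_inj.
by move=> u v _ _; apply: base_inj.
Qed.

Lemma edge_of (u v : G) : adj u v -> [set u; v] \in edges G.
Proof. by move=> uv; apply/imsetP; exists (u, v); rewrite ?inE. Qed.

Definition edge (u v : G) (uv : adj u v) : edge_type G :=
  Sub [set u; v] (edge_of uv).

Lemma edge_nonempty e : exists u, u \in val e.
Proof. by case: e => _ /= /imsetP[[u v] _ ->]; exists u; rewrite /= !inE eqxx. Qed.

(** Replacing a copy by an endpoint of its edge keeps that edge covered. *)
Definition shadow (x : K23 G) : G :=
  match x with inl u => u | inr (e, _) => xchoose (edge_nonempty e) end.

Lemma shadow_copy e i : shadow (copy e i) \in val e.
Proof. exact: xchooseP. Qed.

(** The three copies of an edge are pairwise twins. *)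
Lemma two_copies S (u v : G) (uv : adj u v) (i j : 'I_3) :
  power_dominating S -> base u \notin S -> base v \notin S -> i != j ->
  (copy (edge uv) i \in S) || (copy (edge uv) j \in S).
Proof.
move=> pdS uS vS neq_ij; set e := edge uv.
have neq : copy e i != copy e j by apply: contraNneq neq_ij => -[->].
have twin : open_nbhd (copy e i) = open_nbhd (copy e j).
  by apply/setP => -[w|[f k]]; rewrite !inE.
have := power_dominating_twins pdS neq twin.
rewrite orbA; case/orP => // /exists_inP[[w|[f k]] wS] //=.
by rewrite !inE => /orP[] /eqP wE; [case/negP: uS | case/negP: vS];
  rewrite /base -wE.
Qed.

(** An edge that is not covered by a chosen endpoint has two chosen copies, and
    deleting one vertex leaves at least one of them.  This is why a minimum
    power dominating set contains no copy. *)
Lemma shadow_cover_del S e i : power_dominating S ->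
  vertex_cover (shadow @: (S :\ copy e i)).
Proof.
move=> pdS u v uv; set x := copy e i; set T := S :\ x.
have [uS|uS] := boolP (base u \in S).
  by rewrite (imset_f shadow (_ : base u \in T)) // !inE.
have [vS|vS] := boolP (base v \in S).
  by rewrite (imset_f shadow (_ : base v \in T)) ?orbT // !inE.
pose f := edge uv.
suff [j jT] : exists j, copy f j \in T.
  have := shadow_copy f j; rewrite !inE.
  by case/orP => /eqP <-; rewrite (imset_f shadow jT) ?orbT.
have neq (j : 'I_3) : j != i -> copy f j != x by apply: contraNneq => -[_ ->].
(* The two copies with index other than i: one of them is chosen. *)
have [j [k [ji ki jk]]] : exists j k : 'I_3, [/\ j != i, k != i & j != k].
  by exists (inord (i.+1 %% 3)), (inord (i.+2 %% 3));
    case: i {x T neq} => -[|[|[|]]] //= ?; rewrite -!val_eqE /= !inordK.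
have /orP[] := two_copies uv pdS uS vS jk => zS.
  by exists j; rewrite !inE neq.
by exists k; rewrite !inE neq.
Qed.

Lemma shadow_cover S : power_dominating S -> vertex_cover (shadow @: S).
Proof.
move=> pdS u v uv.
have sub : shadow @: (S :\ copy (edge uv) ord0) \subset shadow @: S.
  exact/imsetS/subD1set.
by case/orP: (shadow_cover_del (edge uv) ord0 pdS uv) => /(subsetP sub) ->;
  rewrite ?orbT.
Qed.

Hypothesis no_isolated : forall u : G, exists v, adj u v.

(** Two steps suffice: the copies are all adjacent to the cover, and any copy of
    an edge uv with u unmonitored has v in the cover, hence forces u. *)
Lemma cover_power_dominating C :
  0 < #|G| -> vertex_cover C -> power_dominating (base @: C).
Proof.
move=> /card_gt0P[u0 _] coverC; split.
  have [v0 uv0] := no_isolated u0.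
  have /orP[] := coverC _ _ uv0 => wC; apply/set0Pn.
    by exists (base u0); apply: imset_f.
  by exists (base v0); apply: imset_f.
set S := base @: C; set P := closed_nbhd_set S.
have baseP u : u \in C -> base u \in P.
  by move=> uC; apply/bigcupP; exists (base u); rewrite ?imset_f // !inE eqxx.
have copyP e i : copy e i \in P.
  have [w wC we] : exists2 w, w \in C & w \in val e.
    case: e => _ /= /imsetP[[u v] uv ->] /=; rewrite inE /= in uv.
    by have /orP[wC|wC] := coverC _ _ uv;
      [exists u | exists v]; rewrite // !inE eqxx ?orbT.
  by apply/bigcupP; exists (base w); rewrite ?imset_f // !inE.
exists 2; apply/setP => x; rewrite [RHS]inE -[monitored S 2]/(force P) inE.
case: x => [u|[e i]]; last by rewrite [_ \in P]copyP.
rewrite -/(base u); have [//|uP /=] := boolP (base u \in P).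
have [v uv] := no_isolated u.
have uC : u \notin C by apply/negP => /baseP; apply/negP.
have vC : v \in C by move: (coverC _ _ uv); rewrite (negPf uC).
pose e := edge uv.
rewrite inE; apply/exists_inP; exists (copy e ord0) => //.
apply/eqP/setP => -[w|[f k]]; rewrite !inE //=; last by rewrite andbF.
rewrite -/(base w) -/(base u) (inj_eq base_inj) in_set2.
have [->|_] := eqVneq w u; first by rewrite uP.
by have [->|_] := eqVneq w v; rewrite ?(baseP _ vC) ?andbF.
Qed.

(** Covers are power dominating and shadows are covers that are no larger, so
    the two minima agree; a copy in S would give a smaller shadow. *)
Lemma min_power_dominatingP S : 0 < #|G| ->
  min_power_dominating S <->
  exists2 C : {set G}, min_vertex_cover C & S = base @: C.
Proof.
move=> G_gt0; split=> [[pdS minS]|[C [coverC minC] ->]]; last first.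
  split=> [|T pdT]; first exact: cover_power_dominating.
  rewrite card_imset; last exact: base_inj.
  by rewrite (leq_trans (minC _ (shadow_cover pdT))) ?leq_imset_card.
have minS' C : vertex_cover C -> #|S| <= #|C|.
  move=> coverC; rewrite -(card_imset (mem C) base_inj).
  exact/minS/cover_power_dominating.
have noCopy e i : copy e i \notin S.
  apply/negP => xS; have := minS' _ (shadow_cover_del e i pdS).
  apply/negP; rewrite -ltnNge (cardsD1 (copy e i) S) xS add1n ltnS.
  exact: leq_imset_card.
have SE : S = base @: (shadow @: S).
  rewrite -imset_comp; apply/setP => x; apply/idP/imsetP => [xS|[y yS ->]].
    exists x => //; case: x xS => [//|[e i]] xS.
    by have := noCopy e i; rewrite /copy xS.
  case: y yS => [//|[e i]] yS.
  by have := noCopy e i; rewrite /copy yS.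
exists (shadow @: S) => //; split=> [|D coverD]; first exact: shadow_cover.
by rewrite (leq_trans (leq_imset_card _ _)) ?minS'.
Qed.

End K23Theory.

(** * Minimum vertex covers of the path on 2r vertices *)

Section EvenPath.

Variable r : nat.

Let P := path_graph (2 * r).

Implicit Types (C : {set P}) (i : P) (k : 'I_r) (j : nat).

Lemma pair_subproof i : i./2 < r.
Proof. have := ltn_ord i; lia. Qed.

Definition pair_of i : 'I_r := Ordinal (pair_subproof i).

Lemma even_subproof k : 2 * k < 2 * r. Proof. have := ltn_ord k; lia. Qed.
Lemma odd_subproof k : (2 * k).+1 < 2 * r. Proof. have := ltn_ord k; lia. Qed.
Definition evenv k : P := Ordinal (even_subproof k).
Definition oddv k : P := Ordinal (odd_subproof k).

Lemma pair_evenv k : pair_of (evenv k) = k.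
Proof. by apply: val_inj => /=; lia. Qed.

Lemma pair_oddv k : pair_of (oddv k) = k.
Proof. by apply: val_inj => /=; lia. Qed.

Lemma evenvVoddv i : i = (if odd i then oddv else evenv) (pair_of i).
Proof. by apply: val_inj; case: ifP => /=; lia. Qed.

(** The pairs form a matching, so a cover meets every one of them. *)
Lemma cover_pairs C : vertex_cover C -> pair_of @: C = [set: 'I_r].
Proof.
move=> coverC; apply/setP => k; rewrite inE; apply/imsetP.
have : adj (evenv k) (oddv k) by rewrite /= /path_adj eqxx.
case/coverC/orP => kC.
  by exists (evenv k); rewrite ?pair_evenv.
by exists (oddv k); rewrite ?pair_oddv.
Qed.

Lemma cover_card C : vertex_cover C -> r <= #|C|.
Proof.
by move=> /cover_pairs CE; rewrite -{1}[r]card_ord -cardsT -CE leq_imset_card.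
Qed.

(** The cover with the odd vertex in the first j pairs and the even vertex in
    the remaining ones. *)
Definition staircase j : {set P} := [set i : P | odd i == (i < 2 * j)].

Lemma staircase_cover j : vertex_cover (staircase j).
Proof.
move=> u v; rewrite /= /path_adj !inE => /orP[] /eqP <- /=; lia.
Qed.

Lemma pair_staircase_inj j : {in staircase j &, injective pair_of}.
Proof.
move=> u v; rewrite !inE => uj vj [uv]; apply: val_inj => /=.
by move: (nat_of_ord u) (nat_of_ord v) uj vj uv => a b /eqP aj /eqP bj; lia.
Qed.

Lemma card_staircase j : #|staircase j| = r.
Proof.
rewrite -(card_in_imset (@pair_staircase_inj j)).
by rewrite (cover_pairs (@staircase_cover j)) cardsT card_ord.
Qed.

(** A cover of size r has exactly one vertex in each pair.  Its threshold j is
    the first pair whose odd vertex is missing, or r if there is none; from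
    there on, the edges between consecutive pairs keep all odd vertices out. *)
Lemma min_cover_staircase C :
  min_vertex_cover C <-> exists j : 'I_r.+1, C = staircase j.
Proof.
split=> [[coverC minC]|[j ->]]; last first.
  by split=> [|D /cover_card]; rewrite ?card_staircase //; apply: staircase_cover.
have inj_pair : {in C &, injective pair_of}.
  apply/imset_injP; rewrite eqn_leq leq_imset_card cover_pairs // cardsT card_ord.
  by rewrite -(card_staircase 0) minC //; apply: staircase_cover.
have evenE k : (evenv k \in C) = (oddv k \notin C).
  have /coverC : adj (evenv k) (oddv k) by rewrite /= /path_adj eqxx.
  have [oC|//] := boolP (oddv k \in C); last by rewrite orbF.
  move=> _; apply/negP => eC.
  have /(congr1 val) /= := inj_pair _ _ eC oC (etrans (pair_evenv k) (esym (pair_oddv k))).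
  lia.
have oddS k k' : k' = k.+1 :> nat -> oddv k' \in C -> oddv k \in C.
  move=> kk' oC; have : adj (oddv k) (evenv k').
    by rewrite /= /path_adj /= kk' mulnS eqxx.
  by case/coverC/orP => //; rewrite evenE oC.
pose stop n := [forall k : 'I_r, (k == n :> nat) ==> (oddv k \notin C)].
have stop_r : stop r by apply/forallP => k; rewrite ltn_eqF.
have [|j /forallP stop_j min_j] := @ex_minnP stop; first by exists r.
have oddE k : (oddv k \in C) = (k < j).
  case: (ltnP k j) => [kj|].
    apply: contraTT kj => kC; rewrite -leqNgt; apply: min_j.
    by apply/forallP => k'; apply/implyP => /eqP/val_inj ->.
  case: k => n; elim: n => [|n IHn] nr jn.
    apply/negbTE; apply: (implyP (stop_j (Ordinal nr))); move: jn => /=; lia.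
  have [jn'|jn'] := leqP j n.
    have nr' : n < r by lia.
    have := IHn nr' jn'; apply: contraFF; exact: oddS.
  by apply/negbTE; apply: (implyP (stop_j (Ordinal nr))); move: jn => /=; lia.
have jr : j < r.+1 by rewrite ltnS min_j.
exists (Ordinal jr); apply/setP => i; rewrite inE {1}[i]evenvVoddv /=.
by case: ifP => oi; rewrite ?evenE oddE /=; move: (nat_of_ord i) oi => a; lia.
Qed.

Lemma card_initial j : j <= r -> #|[set k : 'I_r | k < j]| = j.
Proof.
move=> jr; have widen_inj : injective (widen_ord jr).
  by move=> k l /(congr1 val) /= /val_inj.
rewrite -[RHS]card_ord -(card_imset _ widen_inj).
apply: eq_card => k; rewrite inE; apply/idP/imsetP => [kj|[l _ ->]] //=.
by exists (Ordinal kj) => //; apply: val_inj.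
Qed.

(** Mapping vertices to their pairs is injective on a staircase, so the
    difference is counted by the pairs between the two thresholds. *)
Lemma staircase_diff j1 j2 : j1 <= r -> j2 <= r ->
  #|staircase j1 :\: staircase j2| = (j1 - j2) + (j2 - j1).
Proof.
move=> j1r j2r.
wlog le12 : j1 j2 j1r j2r / j1 <= j2.
  (* Both staircases have r elements, so the two differences have equal size. *)
  move=> IH; have [/IH->//|/ltnW/IH] := leqP j1 j2.
  rewrite addnC => <- //; apply/eqP.
  rewrite -(eqn_add2l #|staircase j1 :&: staircase j2|) cardsID.
  by rewrite setIC cardsID !card_staircase.
have /card_in_imset <- : {in staircase j1 :\: staircase j2 &, injective pair_of}.
  by move=> u v /setDP[uj _] /setDP[vj _]; apply: pair_staircase_inj uj vj.
transitivity #|[set k : 'I_r | k < j2] :\: [set k : 'I_r | k < j1]|; last first.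
  rewrite cardsD (setIidPr _) ?card_initial //; first lia.
  by apply/subsetP => k; rewrite !inE; lia.
apply: eq_card => k; rewrite !inE; apply/imsetP/idP => [[i]|kj].
  by rewrite !inE => + -> /=; move: (nat_of_ord i) => a; lia.
by exists (evenv k); rewrite ?pair_evenv // !inE /=; lia.
Qed.

End EvenPath.

(** * The reconfiguration graph *)

Theorem proposition5p8 (r : nat) (hr : 2 <= r) :
  isomorphic (PD_TJ (K23 (path_graph (2 * r)))) (path_graph r.+1).
Proof.
set P := path_graph (2 * r).
have noIso (u : P) : exists v : P, adj u v.
  pose k := pair_of u; exists ((if odd u then @evenv r else @oddv r) k).
  by rewrite {1}[u]evenvVoddv; case: ifP => _; rewrite /= /path_adj eqxx ?orbT.
have P_gt0 : 0 < #|P| by rewrite card_ord; lia.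
have minP S := min_power_dominatingP noIso S P_gt0.
have stairP (j : 'I_r.+1) :
    `[< min_power_dominating (@base P @: staircase r j) >].
  apply/asboolP/minP; exists (staircase r j) => //.
  by apply/min_cover_staircase; exists j.
pose g (j : path_graph r.+1) : PD_TJ (K23 P) :=
    Sub (@base P @: staircase r j) (stairP j).
have diffE (i j : 'I_r.+1) : #|val (g i) :\: val (g j)| = (i - j) + (j - i).
  by rewrite -(@staircase_diff r) ?leq_ord //= card_base_diff.
have g_surj S : exists j, g j == S.
  have /asboolP/minP[C /min_cover_staircase[j CE] SE] := valP S.
  by exists j; apply/eqP/val_inj; rewrite /= SE CE.
pose h S := xchoose (g_surj S).
have hK : cancel h g by move=> S; exact: eqP (xchooseP (g_surj S)).
have g_inj : injective g.
  move=> i j gij; apply: val_inj => /=.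
  by have := diffE i j; rewrite gij setDv cards0; lia.
have gadj (i j : 'I_r.+1) : adj (g i) (g j) = path_adj i j.
  rewrite -[LHS]/((#|val (g i) :\: val (g j)| == 1)
                  && (#|val (g j) :\: val (g i)| == 1)) !diffE /path_adj.
  by move: (nat_of_ord i) (nat_of_ord j) => a b; lia.
exists h; first by apply: (Bijective hK) => j; apply: g_inj.
move=> S T; transitivity (adj (g (h S)) (g (h T))); first by rewrite gadj.
by rewrite (hK S) (hK T).
Qed.
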